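(* Let $D=\{2^i\mid i\in\mathbb{Z}_{\geq 0}\}$. Then for every positive integer $k$, \[ \Delta(D,k)\geq 2^{\sqrt{2k}}\left(\frac{(\sqrt{2}-1)k}{8}-\frac{\sqrt{k}}{8}\right)+\frac{\sqrt{k}}{2}. \]
   Context: For a set $D$ of positive integers, a $D$-diffsequence of length $k$ is a sequence of positive integers $a_1<a_2<\dots<a_k$ such that $a_i-a_{i-1}\in D$ for $i=2,3,\dots,k$. For a positive integer $k$, $\Delta(D,k)$ denotes the smallest positive integer $n$ such that every $2$-coloring of $\{1,2,\dots,n\}$ contains a monochromatic $D$-diffsequence of length $k$. For $D=\{2^i\mid i\in\mathbb{Z}_{\geq 0}\}$ it is known (Landman and Robertson) that $\Delta(D,k)$ exists for every $k$, with $\Delta(D,k)\leq 2^k-1$. *)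

(* Defs.v *)
From mathcomp Require Import all_boot all_order all_algebra.
From mathcomp Require Import all_classical all_reals all_analysis.

Set Implicit Arguments.
Unset Strict Implicit.
Unset Printing Implicit Defensive.

Local Open Scope classical_set_scope.
Local Open Scope nat_scope.

(* The subtraction is truncated, but harmlessly so: a is strictly increasing. *)
Definition diffsequence (D : set nat) (k : nat) (a : seq nat) : Prop :=
  [/\ size a = k, all (fun x => 0 < x) a, sorted ltn a
    & forall i, i.+1 < k -> D (nth 0 a i.+1 - nth 0 a i)].

Definition monochromatic (c : nat -> bool) (a : seq nat) : Prop :=
  exists b : bool, {in a, forall x, c x = b}.

(* A 2-coloring of {1, ..., n} is given by a total function c : nat -> bool;
   only its values on {1, ..., n} matter, since a lies in that interval. *)
Definition forces (D : set nat) (k n : nat) : Prop :=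
  forall c : nat -> bool, exists a : seq nat,
    [/\ diffsequence D k a, {in a, forall x, x <= n} & monochromatic c a].

Definition is_Delta (D : set nat) (k n : nat) : Prop :=
  [/\ 0 < n, forces D k n & forall m, 0 < m -> forces D k m -> n <= m].

(* Defaults to 0 when no n has the property; Delta_pow2P below shows that the
   default is not used for the powers of 2. *)
Definition Delta (D : set nat) (k : nat) : nat :=
  xget 0 [set n | is_Delta D k n].

Definition pow2 : set nat := [set 2 ^ i | i in [set: nat]].

Lemma forces_pow2 k : 0 < k -> forces pow2 k (k.-1 * 2 ^ k.-1).+1.
Proof.
case: k => // k _ /= c; apply: contrapT => noseq.
have srt s y : sorted ltn s -> last 0 s < y -> sorted ltn (rcons s y).
  by case: s => //= x s; rewrite rcons_path => ->.
have ext r : r <= k -> exists a, [/\ diffsequence pow2 r.+1 a,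
    last 0 a <= (r * 2 ^ k).+1 & {in a, forall x, c x = c 1}].
  elim: r => [_|r IHr ltrk].
    by exists [:: 1]; split=> // x; rewrite inE => /eqP->.
  have [a [[sz_a pos_a lt_a Da] le_a ca]] := IHr (ltnW ltrk).
  set p := last 0 a in le_a.
  have [[i leik ci]|noext] := pselect (exists2 i, i <= k & c (p + 2 ^ i) = c 1).
    exists (rcons a (p + 2 ^ i)); split.
    - split.
      + by rewrite size_rcons sz_a.
      + by rewrite all_rcons pos_a addn_gt0 expn_gt0 orbT.
      + by apply: srt => //; rewrite -addn1 leq_add2l expn_gt0.
      + move=> j; rewrite ltnS => ltjr; rewrite !nth_rcons sz_a ltjr.
        case: ltnP => [ltj|lej]; first exact: Da.
        have ej : j = r by apply: anti_leq; apply/andP.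
        by exists i => //; rewrite ej eqxx /p -nth_last sz_a /= addKn.
    - rewrite last_rcons mulSn addnC -addnS leq_add // leq_exp2l //.
    - by move=> x; rewrite mem_rcons inE => /orP[/eqP->|/ca].
  case: noseq; exists (mkseq (fun i => p + 2 ^ i) k.+1); split.
  - split.
    + by rewrite size_mkseq.
    + by apply/allP => x /mapP[i _ ->]; rewrite addn_gt0 expn_gt0 orbT.
    + apply/(sortedP 0) => i; rewrite size_mkseq => ltik.
      by rewrite !nth_mkseq ?(ltnW ltik) //= ltn_add2l ltn_exp2l.
    + move=> i ltik; rewrite !nth_mkseq ?(ltnW ltik) //.
      by exists i => //; rewrite subnDl expnS mul2n -addnn addnK.
  - move=> x /mapP[i]; rewrite mem_iota add0n ltnS => /= leik ->.
    apply: (leq_trans (leq_add le_a (leqnn _))).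
    rewrite addSn ltnS (@leq_trans (r.+1 * 2 ^ k)) ?leq_mul2r ?ltrk ?orbT //.
    by rewrite mulSn addnC leq_add2r leq_exp2l.
  - exists (~~ c 1) => x /mapP[i]; rewrite mem_iota add0n ltnS => /= leik ->.
    case e: (c (p + 2 ^ i) == c 1).
      by case: noext; exists i => //; apply/eqP.
    by move: e; case: (c _); case: (c 1).
have [a [Da le_a ca]] := ext k (leqnn k).
apply: noseq; exists a; split=> //; last by exists (c 1).
case: Da => sz_a _ lt_a _ x xa; apply: leq_trans le_a.
rewrite -nth_last -(nth_index 0 xa).
have ltx : index x a < size a by rewrite index_mem.
rewrite (sorted_leq_nth leq_trans leqnn 0) ?inE //.
- by apply: sub_sorted lt_a => u v; apply: ltnW.
- by rewrite prednK // (leq_ltn_trans _ ltx).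
- by rewrite -ltnS prednK // (leq_ltn_trans _ ltx).
Qed.

Lemma Delta_pow2P k : 0 < k -> is_Delta pow2 k (Delta pow2 k).
Proof.
move=> k0; rewrite /Delta; case: xgetP => [n -> //|/= none].
have ex : exists n, `[< 0 < n /\ forces pow2 k n >].
  by exists (k.-1 * 2 ^ k.-1).+1; apply/asboolP; split=> //; apply: forces_pow2.
case: (ex_minnP ex) => n /asboolP[n0 fn] min_n.
case: (none n); split=> // m m0 fm.
by apply: min_n; apply/asboolP.
Qed.

(* Main.v *)
(* Colour x by a generalised Thue-Morse rule: write x = (q 2^m + y) B + s with
   s < B = 2^p and y < 2^m, and take the parity of q plus the number of binary
   ones of y.  A step x -> x + 2^i that keeps the colour cannot create a one:
   it replaces a block 0 1^j by 1 0^j with j odd, or raises q by at least 2, or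
   only moves s.  Weighting the one at position i of y by m - i, all these
   steps decrease a potential of size about m^2 / 2 + Q / 2 + 2B, where q < Q.
   The carries out of s are harmless because such a carry clears the lowest bit
   of y for good, so it happens at most once.  With t = sqrt (2k), m close to
   t - 2 and B, Q of order t, this colours an interval of length
   2^m B Q >= k 2^t / 8. *)
Require Import Defs.
From mathcomp Require Import all_boot all_order all_algebra.
From mathcomp Require Import all_classical all_reals all_analysis.
From mathcomp Require Import zify lra.
Import Order.TTheory GRing.Theory Num.Theory.
Local Open Scope ring_scope.

Section Coloring.
Set Implicit Arguments.
Unset Strict Implicit.
Local Open Scope nat_scope.

(** * The digit colouring and its weight *)

Fixpoint thue_morse (m z : nat) : bool :=
  if m is m'.+1 then odd z (+) thue_morse m' z./2 else odd z.

(* The potential is doubled, since a step of 2 in q must count for 1. *)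
Fixpoint weight (Q m z : nat) : nat :=
  if m is m'.+1 then odd z * (2 * m) + weight Q m' z./2 else Q.-1 - z.

(** Adding 1 to an even number changes only its lowest digit, so the colour flips. *)
Lemma thue_morse_succ_odd m z :
  thue_morse m z.+1 = thue_morse m z -> odd z.
Proof.
case: m => [|m] /=; first by case: odd.
by rewrite uphalf_half; case: odd => //=; case: thue_morse.
Qed.

(** Whatever the colours, a carry creates at most one new one, of weight at most [2 * m]. *)
Lemma weight_succ Q m z : weight Q m z.+1 <= weight Q m z + 2 * m.
Proof.
elim: m z => [|m IHm] z /=; first lia.
rewrite uphalf_half; have := IHm z./2; case: odd => /=; rewrite ?add0n ?add1n; lia.
Qed.

Lemma weight_bound Q m z : weight Q m z <= Q.-1 + m * m.+1.
Proof.
elim: m z => [|m IHm] z /=; first lia.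
by have := IHm z./2; case: odd => /=; nia.
Qed.

Lemma weight_step Q m z i : z + 2 ^ i < Q * 2 ^ m ->
  thue_morse m (z + 2 ^ i) = thue_morse m z ->
  weight Q m (z + 2 ^ i) + 2 <= weight Q m z.
Proof.
elim: m z i => [|m IHm] z [|i].
- by rewrite /= addn1 /=; case: odd.
(* The bound by [Q] keeps the truncated [Q.-1 - z] exact. *)
- by rewrite /= expnS; have := expn_gt0 2 i; lia.
(* The lowest one, worth [2 * m.+1], is lost, and the carry returns at most [2 * m]. *)
- rewrite expn0 addn1 => _ same; have oz := thue_morse_succ_odd same.
  move: same; rewrite /= uphalf_half oz /= add1n.
  by have := weight_succ Q m z./2; lia.
- have half_step : (z + 2 ^ i.+1)./2 = z./2 + 2 ^ i.
    by rewrite expnS mul2n halfD odd_double andbF add0n doubleK.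
  have odd_step : odd (z + 2 ^ i.+1) = odd z by rewrite oddD oddX addbF.
  move=> ltzQ /=; rewrite half_step odd_step => /addbI same.
  rewrite -addnA leq_add2l IHm //.
  by move: ltzQ; rewrite !expnS; have := odd_double_half z; lia.
Qed.

(** * The block colouring and its potential *)

Definition block_color (p m x : nat) : bool := thue_morse m (x %/ 2 ^ p).

(* The middle term pays for the unique carry out of the block offset. *)
Definition potential (Q p m x : nat) : nat :=
  2 * ((2 ^ p).-1 - x %% 2 ^ p) + odd (x %/ 2 ^ p) * (2 * (2 ^ p).-1)
  + weight Q m (x %/ 2 ^ p).

Lemma potential_bound Q p m x :
  potential Q p m x <= 4 * (2 ^ p).-1 + Q.-1 + m * m.+1.
Proof.
rewrite /potential; have := weight_bound Q m (x %/ 2 ^ p).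
by case: odd => /=; lia.
Qed.

(** Only [i = 0] affects the parity, and then [z] must be odd. Hence the middle term of [potential]
    never grows. *)
Lemma odd_step m z i : thue_morse m (z + 2 ^ i) = thue_morse m z ->
  odd (z + 2 ^ i) <= odd z.
Proof.
case: i => [|i] same; last by rewrite oddD oddX addbF.
by rewrite addn1 in same; rewrite (thue_morse_succ_odd same); case: odd.
Qed.

Lemma potential_step Q p m x i : x + 2 ^ i < 2 ^ p * (Q * 2 ^ m) ->
  block_color p m (x + 2 ^ i) = block_color p m x ->
  potential Q p m (x + 2 ^ i) + 2 <= potential Q p m x.
Proof.
rewrite /block_color /potential => ltxQ.
have B0 : 0 < 2 ^ p by rewrite expn_gt0.
have lt_div : (x + 2 ^ i) %/ 2 ^ p < Q * 2 ^ m by rewrite ltn_divLR // mulnC.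
have ltr := ltn_pmod x B0.
have [lepi|ltip] := leqP p i.
  have e : 2 ^ i = 2 ^ (i - p) * 2 ^ p by rewrite -expnD subnK.
  have div_step : (x + 2 ^ i) %/ 2 ^ p = x %/ 2 ^ p + 2 ^ (i - p).
    by rewrite e addnC divnMDl // addnC.
  have mod_step : (x + 2 ^ i) %% 2 ^ p = x %% 2 ^ p.
    by rewrite e addnC modnMDl.
  rewrite mod_step !div_step in lt_div * => same.
  have := weight_step lt_div same.
  have := odd_step same.
  by do 2 case: odd => /=; lia.
have ltiB : 2 ^ i < 2 ^ p by rewrite ltn_exp2l.
have i0 : 0 < 2 ^ i by rewrite expn_gt0.
have ex := divn_eq x (2 ^ p); set z := x %/ 2 ^ p in ex *.
set s := x %% 2 ^ p in ltr ex *.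
have [nocarry|carry] := ltnP (s + 2 ^ i) (2 ^ p).
  have e : x + 2 ^ i = z * 2 ^ p + (s + 2 ^ i) by lia.
  by rewrite e modnMDl divnMDl // divn_small // modn_small // addn0; lia.
(* The offset falls by at most [2 ^ p - 1]. The middle term, freed as the block index turns from odd
   to even, pays for this; [weight_step] gives the 2. *)
have e : x + 2 ^ i = z.+1 * 2 ^ p + (s + 2 ^ i - 2 ^ p) by lia.
have lts : s + 2 ^ i - 2 ^ p < 2 ^ p by lia.
rewrite e modnMDl divnMDl // divn_small // modn_small // addn0 in lt_div * => same.
have oz := thue_morse_succ_odd same.
rewrite -addn1 in same lt_div; have := @weight_step Q m z 0 lt_div same.
by rewrite expn0 addn1 /= oz /=; lia.
Qed.

Lemma not_forces_pow2 k Q p m n :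
  4 * 2 ^ p + Q + m * m.+1 <= 2 * k + 2 ->
  n < 2 ^ p * (Q * 2 ^ m) -> ~ forces pow2 k n.
Proof.
move=> small ltnN /(_ (block_color p m))[a [[sz _ srt Da] le_n [b mono]]].
have B0 : 0 < 2 ^ p by rewrite expn_gt0.
have Q0 : 0 < Q by case: Q ltnN {small} => //; rewrite mul0n muln0.
have k0 : 0 < k by nia.
have descent j : j < k ->
    2 * j + potential Q p m (nth 0 a j) <= potential Q p m (nth 0 a 0).
  elim: j => [|j IHj] ltjk; first lia.
  have [ltj' ltj1] : j < size a /\ j.+1 < size a by rewrite sz; lia.
  have lt_a : nth 0 a j < nth 0 a j.+1 := sortedP 0 srt j ltj1.
  have [i _ ei] := Da j ltjk.
  have ea : nth 0 a j.+1 = nth 0 a j + 2 ^ i by lia.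
  have := IHj (ltnW ltjk).
  have : nth 0 a j + 2 ^ i < 2 ^ p * (Q * 2 ^ m).
    by rewrite -ea (leq_ltn_trans _ ltnN) // le_n // mem_nth.
  move=> /potential_step; rewrite -ea !mono ?mem_nth // => /(_ erefl).
  lia.
(* The potential starts at [2 * k - 3] at most, but [k - 1] steps cost [2 * (k - 1)]. *)
have := descent k.-1; rewrite prednK // leqnn => /(_ isT).
have := potential_bound Q p m (nth 0 a 0).
lia.
Qed.

Lemma Delta_pow2_lower k Q p m : 0 < k ->
  4 * 2 ^ p + Q + m * m.+1 <= 2 * k + 2 ->
  2 ^ p * (Q * 2 ^ m) <= Delta pow2 k.
Proof.
move=> k0 small; rewrite leqNgt; apply/negP => ltD.
have [_ forcesD _] := Delta_pow2P k0.
exact: not_forces_pow2 small ltD forcesD.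
Qed.

End Coloring.

(** * Choice of the parameters and real estimates *)

Lemma Delta_pow2_exp_sqrt (R : realType) (k : nat) : (1 < k)%N ->
  k%:R * 2 `^ Num.sqrt (2 * k%:R) / 8 <= (Delta pow2 k)%:R :> R.
Proof.
move=> k1; set t : R := Num.sqrt _.
have t0 : 0 <= t by rewrite sqrtr_ge0.
have tt : t ^+ 2 = 2 * k%:R by rewrite sqr_sqrtr // mulr_ge0.
have kR : 2 <= k%:R :> R by rewrite ler_nat.
have t2 : 2 <= t by rewrite -(@ler_pXn2r _ 2) ?nnegrE // tt; lra.
set T := Num.truncn t.
have /andP[leTt lttT] : T%:R <= t < T.+1%:R by apply: truncn_itv.
have T2 : (2 <= T)%N.
  by rewrite -ltnS -(ltr_nat R) (le_lt_trans t2).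
(* This places [2 ^ p] between [t / 4] and [t / 2]. *)
set p := (trunc_log 2 T).-1.
have log0 : (0 < trunc_log 2 T)%N by rewrite trunc_log_gt0.
have logE : trunc_log 2 T = p.+1 by rewrite prednK.
have lowB : (2 * 2 ^ p <= T)%N.
  by rewrite -expnS -logE trunc_logP // (leq_trans _ T2).
have upB : (T < 4 * 2 ^ p)%N.
  have -> : (4 * 2 ^ p = 2 ^ (trunc_log 2 T).+1)%N by rewrite logE !expnS mulnA.
  exact: trunc_log_ltn.
set m := (T - 2)%N.
have sqT : (T * T <= 2 * k)%N.
  rewrite -(ler_nat R) !natrM -tt expr2 ler_pM //.
have small : (4 * 2 ^ p + m * m.+1 <= 2 * k + 2)%N by rewrite /m; nia.
set Q := (2 * k + 2 - (4 * 2 ^ p + m * m.+1))%N.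
have QE : (4 * 2 ^ p + Q + m * m.+1 = 2 * k + 2)%N by rewrite /Q; lia.
have lowD : (2 ^ p * (Q * 2 ^ m) <= Delta pow2 k)%N.
  by apply: Delta_pow2_lower; rewrite ?QE // ltnW.
have mT : m%:R = T%:R - 2 :> R by rewrite /m natrB.
set B : R := (2 ^ p)%:R.
have BT : 2 * B <= t.
  by apply: le_trans leTt; rewrite /B -natrM ler_nat.
have tB : t <= 4 * B.
  by apply: le_trans (ltW lttT) _; rewrite /B -natrM ler_nat.
(* Since [m * m.+1 = (T - 2) * (T - 1)] and [T <= t], [Q] is at least
   [t ^+ 2 + 2 - 4 * B - (t - 1) * (t - 2)]. *)
have QR : 3 * t - 4 * B <= Q%:R.
  have := congr1 (fun n : nat => n%:R : R) QE.
  have TR : 2 <= T%:R :> R by rewrite ler_nat.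
  rewrite /= !natrD !natrM -/B -[m.+1]addn1 natrD mT.
  have : (T%:R - 1) * (T%:R - 2) <= (t - 1) * (t - 2).
    by apply: ler_pM; lra.
  nra.
have BQ : k%:R <= B * Q%:R.
  have B0 : 0 <= B by [].
  have : B * (3 * t - 4 * B) <= B * Q%:R by rewrite ler_wpM2l.
  (* Expanded, this says that [B * (3 * t - 4 * B)] is at least [t ^+ 2 / 2], which is [k]. *)
  have : 0 <= (4 * B - t) * (t - 2 * B) by rewrite mulr_ge0 ?subr_ge0.
  nra.
(* The 8 is [2 ^ 3], from [t < T + 1 = m + 3]. *)
have exp_m : 2 `^ t / 8 <= (2 ^ m)%:R.
  rewrite ler_pdivrMr //.
  apply: (@le_trans _ _ (2 `^ (m + 3)%:R)).
    by apply: ler_powR; [lra | rewrite natrD mT; move: lttT; rewrite -natr1; lra].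
  by rewrite powR_mulrn // exprD natrX ler_wpM2l ?exprn_ge0 //; lra.
move: lowD; rewrite -(ler_nat R) mulnA !natrM -/B; apply: le_trans.
by rewrite -mulrA ler_pM // divr_ge0 // powR_ge0.
Qed.

Theorem theorem1p1 (R : realType) (k : nat) (hk : (0 < k)%N) :
  2 `^ Num.sqrt (2 * k%:R)
    * ((Num.sqrt 2 - 1) * k%:R / 8 - Num.sqrt k%:R / 8)
  + Num.sqrt k%:R / 2
  <= (Delta pow2 k)%:R :> R.
Proof.
have s0 : 0 <= Num.sqrt 2 :> R by rewrite sqrtr_ge0.
have s2 : Num.sqrt 2 <= 2 :> R.
  by rewrite -(@ler_pXn2r _ 2) ?nnegrE // sqr_sqrtr //; lra.
(* For [k = 1] the bracket is nonpositive, so the bound is at most 1/2. *)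
have [k1|k1] := leqP k 1.
  have -> : k = 1%N by apply/anti_leq/andP.
  have [D0 _ _] := Delta_pow2P (ltn0Sn 0).
  have DR : 1 <= (Delta pow2 1)%:R :> R by rewrite ler1n.
  rewrite sqrtr1 !mulr1; have := powR_ge0 2 (Num.sqrt 2 : R).
  nra.
have := Delta_pow2_exp_sqrt R k1; apply: le_trans.
have kR : 2 <= k%:R :> R by rewrite ler_nat.
(* The power being at least 4, the negative root term absorbs the final half root of [k]. *)
have pow4 : 4 <= 2 `^ Num.sqrt (2 * k%:R) :> R.
  have -> : 4 = 2 `^ 2%:R :> R by rewrite powR_mulrn //; lra.
  apply: ler_powR; first lra.
  by rewrite -(@ler_pXn2r _ 2) ?nnegrE ?sqrtr_ge0 // sqr_sqrtr; lra.
set P := 2 `^ _ in pow4 *.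
have r0 : 0 <= Num.sqrt k%:R :> R by rewrite sqrtr_ge0.
have : (Num.sqrt 2 - 1) * k%:R <= 1 * k%:R :> R by rewrite ler_wpM2r //; lra.
set u := (Num.sqrt 2 - 1) * k%:R; set r := Num.sqrt k%:R in r0 * => uk.
have : 0 <= P * (k%:R - u) by rewrite mulr_ge0 //; lra.
have : 0 <= (P - 4) * r by rewrite mulr_ge0 //; lra.
nra.
Qed.
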